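(* There is a constant $c>0$ such that the online matrix completion algorithm with side information described in the context, run with $\eta=c\gamma^2$, achieves, for every sequence $\mathcal{S}=((i_1,j_1),y_1),\dots,((i_T,j_T),y_T)$ in $[m]\times[n]\times\{-1,1\}$, $$M=\sum_{t=1}^T\mathbb{I}_{\hat y_t\neq y_t}=O\left(\frac{\widehat{\mathcal{D}}}{\gamma^2}\right)+2\,\mathrm{hloss}(\mathcal{S},\gamma),$$ where $O(\cdot)$ hides an absolute constant.
   Context: Notation: $[k]=\{1,\dots,k\}$; $\mathbb{S}^{k\times k}_{++}$ is the set of real symmetric strictly positive definite $k\times k$ matrices; $\bm{E}$ is the identity matrix; $\bm{A}\bullet\bm{B}=\sum_{i,j}\bm{A}_{i,j}\bm{B}_{i,j}$; $\bm{e}_k$ is the $k$-th standard basis vector of $\mathbb{R}^N$; $\mathbb{I}$ is the $0/1$ indicator; $N=m+n$; $\bm{A}_i$ is the $i$-th row of $\bm{A}$. For $\bm{M}\in\mathbb{S}^{m\times m}_{++}$, $\mathcal{R}_{\bm{M}}=\max_{i}(\bm{M}^{+})_{ii}$ with $\bm{M}^+$ the pseudo-inverse (similarly for $\bm{N}$). Parameters: $\gamma>0$, $\eta>0$, side information matrices $\bm{M}\in\mathbb{S}^{m\times m}_{++}$, $\bm{N}\in\mathbb{S}^{n\times n}_{++}$, and a quasi-dimension estimator $\widehat{\mathcal{D}}\ge1$. Put $$\bm{\Gamma}=\begin{bmatrix}\sqrt{\mathcal{R}_{\bm{M}}}\sqrt{\bm{M}}&0\\0&\sqrt{\mathcal{R}_{\bm{N}}}\sqrt{\bm{N}}\end{bmatrix},\qquad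 \mathcal{K}=\{\bm{W}\in\mathbb{S}^{N\times N}_{++}:\ \forall i\in[N],\ \bm{W}_{i,i}\le1,\ \mathrm{Tr}(\bm{\Gamma}\bm{W}\bm{\Gamma})\le\widehat{\mathcal{D}}\}.$$ Algorithm. Initialize with an arbitrary $\bm{W}_1\in\mathcal{K}$. In each round $t=1,\dots,T$: receive $(i_t,j_t)\in[m]\times[n]$; let $\bm{Z}_t=\frac12(\bm{e}_{i_t}\bm{e}_{m+j_t}^T+\bm{e}_{m+j_t}\bm{e}_{i_t}^T)$; predict $\hat y_t=\mathrm{sgn}(\bm{W}_t\bullet\bm{Z}_t)$; receive $y_t\in\{-1,1\}$. If $\hat y_t\ne y_t$, let $\bm{L}_t=-\frac{y_t}{\gamma}\bm{Z}_t$ and $$\bm{W}_{t+1}=\arg\min_{\bm{W}\in\mathcal{K}}\left(-\ln\det(\bm{\Gamma}\bm{W}\bm{\Gamma}+\bm{E})+\eta\sum_{s=1}^t\bm{W}\bullet\bm{L}_s\right);$$ otherwise let $\bm{L}_t=0$ and $\bm{W}_{t+1}=\bm{W}_t$. Hinge loss. $h_\gamma(x)=0$ if $\gamma\le x$ and $h_\gamma(x)=1-x/\gamma$ otherwise. For $\bm{P}\in\mathbb{R}^{m\times d}$, $\bm{Q}\in\mathbb{R}^{n\times d}$ (any $d$, nonzero rows), $\bar{\bm{P}},\bar{\bm{Q}}$ are obtained by dividing each row by its Euclidean norm, and $$\mathrm{hloss}(\mathcal{S},(\bm{P},\bm{Q}),\gamma)=\sum_{t=1}^Th_\gamma\left(\frac{y_t\bm{P}_{i_t}\bm{Q}_{j_t}^T}{\|\bm{P}_{i_t}\|_2\|\bm{Q}_{j_t}\|_2}\right).$$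 Let $\mathcal{X}$ be the set of matrices $\bar{\bm{P}}\bar{\bm{Q}}^T\in[-1,1]^{m\times n}$ over all such $\bm{P},\bm{Q}$ with $\mathcal{R}_{\bm{M}}\mathrm{Tr}(\bar{\bm{P}}^T\bm{M}\bar{\bm{P}})+\mathcal{R}_{\bm{N}}\mathrm{Tr}(\bar{\bm{Q}}^T\bm{N}\bar{\bm{Q}})\le\widehat{\mathcal{D}}$. Then $\mathrm{hloss}(\mathcal{S},\gamma)=\min_{\bar{\bm{P}}\bar{\bm{Q}}^T\in\mathcal{X}}\mathrm{hloss}(\mathcal{S},(\bm{P},\bm{Q}),\gamma)$. *)

(* Defs.v *)
From HB Require Import structures.
From mathcomp Require Import all_boot all_order all_algebra.
From mathcomp Require Import all_classical all_reals all_analysis.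

Set Implicit Arguments.
Unset Strict Implicit.
Unset Printing Implicit Defensive.

Import Order.TTheory GRing.Theory Num.Theory.

Local Open Scope classical_set_scope.
Local Open Scope ring_scope.

Section Matrices.
Context {R : realType}.

Definition posdefmx k (A : 'M[R]_k) : Prop :=
  A^T = A /\ forall x : 'cV[R]_k, x != 0 -> 0 < (x^T *m A *m x) 0 0.

Definition possemidefmx k (A : 'M[R]_k) : Prop :=
  A^T = A /\ forall x : 'cV[R]_k, 0 <= (x^T *m A *m x) 0 0.

(* [S] is the (unique) positive semidefinite square root of [A]. *)
Definition is_sqrtmx k (S A : 'M[R]_k) : Prop :=
  possemidefmx S /\ S *m S = A.

(* The four Penrose equations: [X] is the Moore-Penrose pseudo-inverse of [A].
   MathComp's [pinvmx] is only a partial inverse, without the symmetry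
   conditions. *)
Definition is_mppinv k (A X : 'M[R]_k) : Prop :=
  [/\ A *m X *m A = A, X *m A *m X = X,
      (A *m X)^T = A *m X & (X *m A)^T = X *m A].

Definition mppinv k (A : 'M[R]_k) : 'M[R]_k := xget 0 [set X | is_mppinv A X].

(* The squared radius max_i (A^+)_ii; the neutral element 0 of the maximum is
   harmless because the diagonal of A^+ is positive when A is positive
   definite. *)
Definition radius k (A : 'M[R]_k) : R :=
  \big[Num.max/0]_(i < k) mppinv A i i.

Definition frob k (A B : 'M[R]_k) : R := \sum_i \sum_j A i j * B i j.

Definition l2norm d (v : 'rV[R]_d) : R := Num.sqrt (\sum_k v 0 k ^+ 2).

Definition normalize_rows k d (P : 'M[R]_(k, d)) : 'M[R]_(k, d) :=
  \matrix_(i, j) (P i j / l2norm (row i P)).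

Definition is_argmin (T : Type) (K : set T) (f : T -> R) (x : T) : Prop :=
  K x /\ forall x', K x' -> f x <= f x'.

(* The sign function, with an arbitrary value [s0] at the origin. *)
Definition sgn (s0 x : R) : R := if x == 0 then s0 else Num.sg x.

End Matrices.

Section Algorithm.
Context {R : realType} {m n T : nat}.

(* [sqM] and [sqN] stand for the square roots of [M] and [N]. *)
Definition Gamma (M sqM : 'M[R]_m) (N sqN : 'M[R]_n) : 'M[R]_(m + n) :=
  block_mx (Num.sqrt (radius M) *: sqM) 0 0 (Num.sqrt (radius N) *: sqN).

Definition feasible (G : 'M[R]_(m + n)) (D : R) : set 'M[R]_(m + n) :=
  [set W | [/\ posdefmx W, forall i, W i i <= 1 & \tr (G *m W *m G) <= D]].

Definition Zmx (i : 'I_m) (j : 'I_n) : 'M[R]_(m + n) :=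
  2^-1 *: (delta_mx (lshift n i) (rshift m j) +
           delta_mx (rshift m j) (lshift n i)).

(* Rounds are numbered from 0: round [t : 'I_T] uses [W t] and produces
   [W t.+1], so that [W 0] is the initial matrix.  [feasible G D] is not closed,
   so a run presupposes that the minimizers it uses are attained. *)
Section Run.
Variables (s0 gamma eta : R) (G : 'M[R]_(m + n)) (D : R).
Variables (i : 'I_T -> 'I_m) (j : 'I_T -> 'I_n) (y : 'I_T -> R).
Variable W : nat -> 'M[R]_(m + n).

Definition prediction (t : 'I_T) : R := sgn s0 (frob (W t) (Zmx (i t) (j t))).

Definition mistake (t : 'I_T) : bool := prediction t != y t.

Definition lossmx (t : 'I_T) : 'M[R]_(m + n) :=
  if mistake t then - (y t / gamma) *: Zmx (i t) (j t) else 0.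

Definition objective (t : 'I_T) (V : 'M[R]_(m + n)) : R :=
  - ln (\det (G *m V *m G + 1%:M))
  + eta * \sum_(s < T | (s <= t)%N) frob V (lossmx s).

Definition is_run : Prop :=
  feasible G D (W 0%N) /\
  forall t : 'I_T,
    if mistake t then is_argmin (feasible G D) (objective t) (W t.+1)
    else W t.+1 = W t.

Definition nb_mistakes : nat := \sum_(t < T) mistake t.

End Run.
End Algorithm.

Section HingeLoss.
Context {R : realType} {m n T : nat}.

Definition hinge (gamma x : R) : R :=
  if gamma <= x then 0 else 1 - x / gamma.

Definition nonzero_rows k d (P : 'M[R]_(k, d)) : Prop :=
  forall i, row i P != 0.

Definition hloss_PQ d (gamma : R)
    (i : 'I_T -> 'I_m) (j : 'I_T -> 'I_n) (y : 'I_T -> R)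
    (P : 'M[R]_(m, d)) (Q : 'M[R]_(n, d)) : R :=
  \sum_(t < T)
    hinge gamma (y t * (row (i t) P *m (row (j t) Q)^T) 0 0
                 / (l2norm (row (i t) P) * l2norm (row (j t) Q))).

Definition comparators (M : 'M[R]_m) (N : 'M[R]_n) (D : R) : set 'M[R]_(m, n) :=
  [set X | exists d (P : 'M[R]_(m, d)) (Q : 'M[R]_(n, d)),
     let Pb := normalize_rows P in
     let Qb := normalize_rows Q in
     [/\ nonzero_rows P, nonzero_rows Q,
         radius M * \tr (Pb^T *m M *m Pb) + radius N * \tr (Qb^T *m N *m Qb)
           <= D
       & X = Pb *m Qb^T]].

(* The minimum over comparators, taken in the extended reals: it is +oo exactly
   when there is no comparator, which happens when [D] is too small. *)
Definition hloss (M : 'M[R]_m) (N : 'M[R]_n) (D gamma : R)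
    (i : 'I_T -> 'I_m) (j : 'I_T -> 'I_n) (y : 'I_T -> R) : \bar R :=
  ereal_inf [set h | exists d (P : 'M[R]_(m, d)) (Q : 'M[R]_(n, d)),
     [/\ nonzero_rows P, nonzero_rows Q,
         comparators M N D (normalize_rows P *m (normalize_rows Q)^T)
       & h = (hloss_PQ gamma i j y P Q)%:E]].

End HingeLoss.

(* Main.v *)
Require Import Defs.
From HB Require Import structures.
From mathcomp Require Import all_boot all_order all_algebra.
From mathcomp Require Import all_classical all_reals all_analysis.
From mathcomp Require Import ring lra.

(** The algorithm follows the regularized leader, and the proof is a regret
    bound for the linear losses [V |-> frob V L_t], compared with the Gram matrix
    of the normalized comparator.

    Range of the regularizer.  On feasible matrices [ln (det (G V G + 1))] lies
    between 0 and [tr (G V G) <= D] ([feasible_ln_det_ge0],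
    [feasible_ln_det_le]).

    Stability.  Up to an additive constant the regularizer is [- ln (det (V + U))]
    where [U] is the inverse of the square of [Gamma].  By the choice of the
    radii the diagonal of [U] is at most 1, so [V + U] has diagonal at most 2.
    For a positive definite matrix with bounded diagonal, the log-determinant is
    strongly concave with respect to every single entry ([ln_det_midpoint],
    [logdet_strong_concavity]), and the loss of a round reads only one entry.
    Therefore a minimizer moves so little in the direction of the next loss that
    one mistake costs a constant multiple of [eta / gamma ^ 2], independently of
    the dimensions ([argmin_quadratic_growth], [follow_the_leader]).  Strong
    concavity is used in its midpoint form, which requires neither derivatives
    nor first-order optimality conditions.

    Conclusion.  Every mistake has nonnegative loss for the algorithm, and the
    comparator's loss on it is at most its hinge loss minus 1
    ([mistakes_le_hinge]).  With [eta = gamma ^ 2 / 16] the stability terms add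
    up to a quarter of the number of mistakes and can be moved to the left-hand
    side ([mistake_bound]).  The comparator's Gram matrix may be singular, hence
    infeasible; it is reached as a limit of feasible mixtures ([regret_semi]). *)

Set Implicit Arguments.
Unset Strict Implicit.
Unset Printing Implicit Defensive.

Import Order.TTheory GRing.Theory Num.Theory.
Local Open Scope ring_scope.

(** * Positive definite matrices *)

Section PositiveDefinite.
Context {R : realType}.

Lemma posdefmx_gt0 k p (A : 'M[R]_k) (x : 'M[R]_(k, p)) (j : 'I_p) :
  posdefmx A -> col j x != 0 -> 0 < (x^T *m A *m x) j j.
Proof.
move=> [_ pA] /pA; rewrite tr_col -row_mul mxE => /lt_le_trans -> //.
by rewrite [leRHS]mxE ler_sum // => l _; rewrite !mxE.
Qed.

Lemma posdefmx_diag_gt0 k (A : 'M[R]_k) i : posdefmx A -> 0 < A i i.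
Proof.
move=> pA; have := @posdefmx_gt0 _ _ _ 1%:M i pA.
rewrite trmx1 mul1mx mulmx1; apply; apply/eqP => /matrixP /(_ i 0).
by rewrite !mxE eqxx => /eqP; rewrite oner_eq0.
Qed.

Lemma posdefmx_unit k (A : 'M[R]_k) : posdefmx A -> A \in unitmx.
Proof.
move=> [_ pA]; rewrite unitmxE unitfE; apply/det0P => -[v v0 vA].
have := pA v^T; rewrite trmx_eq0 v0 trmxK vA mul0mx mxE ltxx.
by move=> /(_ isT).
Qed.

Lemma posdefmx_congr k (A B : 'M[R]_k) :
  posdefmx A -> B \in unitmx -> posdefmx (B *m A *m B^T).
Proof.
move=> [sA pA] uB; split; first by rewrite !trmx_mul trmxK sA mulmxA.
move=> x x0; have -> : x^T *m (B *m A *m B^T) *m x = (B^T *m x)^T *m A *m (B^T *m x).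
  by rewrite trmx_mul trmxK !mulmxA.
apply: pA; apply: contra_neq x0 => Bx0.
by rewrite -(mul1mx x) -(mulVmx (_ : B^T \in unitmx)) ?unitmx_tr // -mulmxA Bx0 mulmx0.
Qed.

Lemma posdefmxD k (A B : 'M[R]_k) :
  possemidefmx A -> posdefmx B -> posdefmx (A + B).
Proof.
move=> [sA pA] [sB pB]; split; first by rewrite linearD /= sA sB.
by move=> x x0; rewrite mulmxDr mulmxDl mxE ltr_wpDl // pB.
Qed.

Lemma posdefmx_semi k (A : 'M[R]_k) : posdefmx A -> possemidefmx A.
Proof.
move=> [sA pA]; split=> // x; have [->|/pA/ltW //] := eqVneq x 0.
by rewrite mulmx0 mxE.
Qed.

Lemma possemidefmxZ k (a : R) (A : 'M[R]_k) :
  0 <= a -> possemidefmx A -> possemidefmx (a *: A).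
Proof.
move=> a0 [sA pA]; split; first by rewrite linearZ /= sA.
by move=> x; rewrite -scalemxAr -scalemxAl mxE mulr_ge0.
Qed.

Lemma posdefmxZ k (a : R) (A : 'M[R]_k) :
  0 < a -> posdefmx A -> posdefmx (a *: A).
Proof.
move=> a0 [sA pA]; split; first by rewrite linearZ /= sA.
by move=> x x0; rewrite -scalemxAr -scalemxAl mxE mulr_gt0// pA.
Qed.

Lemma possemidefmx_gram k d (B : 'M[R]_(k, d)) : possemidefmx (B *m B^T).
Proof.
split; first by rewrite trmx_mul trmxK.
move=> x; have -> : x^T *m (B *m B^T) *m x = (B^T *m x)^T *m (B^T *m x).
  by rewrite trmx_mul trmxK !mulmxA.
by rewrite mxE sumr_ge0 // => i _; rewrite [_^T _ _]mxE -expr2 sqr_ge0.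
Qed.

Lemma posdefmx1 k : posdefmx (1%:M : 'M[R]_k).
Proof.
split; first exact: trmx1.
move=> x x0; rewrite mulmx1 mxE lt_neqAle sumr_ge0 ?andbT; last first.
  by move=> i _; rewrite !mxE -expr2 sqr_ge0.
apply: contra x0; rewrite eq_sym psumr_eq0; last first.
  by move=> i _; rewrite !mxE -expr2 sqr_ge0.
move=> /allP h; apply/eqP/matrixP => i j; rewrite ord1 mxE.
by have := h i (mem_index_enum _); rewrite !mxE -expr2 sqrf_eq0 => /eqP.
Qed.

Lemma posdefmx_inv k (A : 'M[R]_k) : posdefmx A -> posdefmx (invmx A).
Proof.
move=> pA; have uA := posdefmx_unit pA; have [sA _] := pA.
have := posdefmx_congr pA (_ : invmx A \in unitmx); rewrite unitmx_inv.
by rewrite mulVmx // mul1mx trmx_inv sA; apply.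
Qed.

Lemma posdefmx_block k l (A : 'M[R]_k) (B : 'M[R]_l) :
  posdefmx A -> posdefmx B -> posdefmx (block_mx A 0 0 B).
Proof.
move=> [sA pA] [sB pB]; split; first by rewrite tr_block_mx sA sB !trmx0.
move=> x x0; rewrite -(vsubmxK x) tr_col_mx mul_row_block !mulmx0 addr0 add0r.
rewrite mul_row_col mxE.
have [u0|u0] := eqVneq (usubmx x) 0.
  rewrite u0 mulmx0 mxE add0r; apply: pB; apply: contra_neq x0 => d0.
  by rewrite -(vsubmxK x) u0 d0 col_mx0.
rewrite ltr_wpDr ?pA//; by have [_] := posdefmx_semi (conj sB pB); apply.
Qed.

(** The only factorization the proof uses: it replaces the spectral theorem
    both in the log-determinant estimates and in the midpoint inequality.  The
    induction pivots on the first entry, whose Schur complement is again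
    positive definite because elimination is a congruence. *)
Lemma cholesky k (A : 'M[R]_k) : posdefmx A ->
  exists L : 'M[R]_k, is_trig_mx L /\ L *m L^T = A.
Proof.
elim: k A => [|k IH] A pA.
  exists 0; split; first by apply/is_trig_mxP => -[].
  by apply/matrixP => -[].
have a0 : 0 < A 0 0 by exact: posdefmx_diag_gt0.
move: A pA a0; rewrite -[k.+1]/(1 + k)%N => A pA a0.
have [sA _] := pA.
pose a := A 0 0; pose b := dlsubmx A; pose C := drsubmx A.
have aE : ulsubmx A = a%:M.
  by apply/matrixP => i j; rewrite !ord1 !mxE /= mulr1n; congr (A _ _); apply/val_inj.
have bE : ursubmx A = b^T.
  by rewrite /b trmx_dlsub sA.
have AE : A = block_mx a%:M b^T b C by rewrite -aE -bE submxK.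
have pS : posdefmx (C - a^-1 *: (b *m b^T)).
  (* [B] eliminates the first column of [A]. *)
  pose B := block_mx 1%:M 0 (- a^-1 *: b) (1%:M : 'M[R]_k).
  have uB : B \in unitmx by rewrite unitmxE det_lblock !det1 mulr1 unitr1.
  have [sBA pBA] := posdefmx_congr pA uB.
  have BAE : B *m A *m B^T = block_mx a%:M 0 0 (C - a^-1 *: (b *m b^T)).
    rewrite AE /B tr_block_mx !mulmx_block !trmx1 !trmx0 !mul1mx !mulmx1.
    rewrite !mul0mx !addr0 !mulmx0 !addr0.
    have -> : - a^-1 *: b *m a%:M + b = 0.
      rewrite -scalemxAl mul_mx_scalar scalerA mulNr mulVf ?gt_eqF//.
      by rewrite scaleN1r addNr.
    rewrite mul0mx add0r; congr block_mx.
      rewrite linearZ /= mul_scalar_mx scalerA mulrN divff ?gt_eqF//.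
      by rewrite scaleN1r addNr.
    by rewrite -scalemxAl scaleNr addrC.
  split.
    have := congr1 drsubmx sBA.
    by rewrite BAE tr_block_mx !block_mxKdr.
  move=> x x0; have := pBA (col_mx 0 x).
  rewrite BAE tr_col_mx mul_row_block mul_row_col !mulmx0 !add0r.
  by apply; rewrite col_mx_eq0 negb_and x0 orbT.
have [L [tL LE]] := IH _ pS.
exists (block_mx (Num.sqrt a)%:M 0 ((Num.sqrt a)^-1 *: b) L); split.
  by rewrite is_trig_block_mx // eqxx /= tL andbT; apply/is_trig_mxP => i j; rewrite !ord1.
have s0 : Num.sqrt a != 0 by rewrite gt_eqF // sqrtr_gt0.
have ssE : Num.sqrt a * Num.sqrt a = a by rewrite -expr2 sqr_sqrtr // ltW.
rewrite tr_block_mx mulmx_block !trmx0 !mulmx0 !mul0mx !addr0 AE.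
rewrite tr_scalar_mx -scalar_mxM ssE linearZ /= mul_scalar_mx mul_mx_scalar.
rewrite !scalerA (mulfV s0) !scale1r; congr block_mx.
by rewrite LE -scalemxAl -scalemxAr scalerA -invfM ssE addrC subrK.
Qed.

End PositiveDefinite.

(** * Log-determinant inequalities *)

Section LogDet.
Context {R : realType}.

Lemma posdefmx_det_gt0 k (A : 'M[R]_k) : posdefmx A -> 0 < \det A.
Proof.
move=> pA; have := posdefmx_unit pA; have [L [_ LE]] := cholesky pA.
by rewrite -LE unitmxE unitfE det_mulmx det_tr -expr2 lt_neqAle sqr_ge0 eq_sym => ->.
Qed.

(** Hadamard's inequality followed by [1 + x <= expR x]: a diagonal entry of
    [A = L L^T] dominates the square of the corresponding entry of [L].  All
    bounds on log-determinants below rest on this one. *)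
Lemma ln_det_le_tr k (A : 'M[R]_k) : posdefmx A ->
  ln (\det A) <= \tr A - k%:R.
Proof.
move=> pA; have [L [tL LE]] := cholesky pA.
rewrite -[leRHS]expRK ler_ln ?posrE ?expR_gt0 ?posdefmx_det_gt0//.
have -> : \tr A - k%:R = \sum_i (A i i - 1).
  by rewrite sumrB /mxtrace sumr_const card_ord.
rewrite (big_morph _ (@expRD R) (@expR0 R)) -{1}LE det_mulmx det_tr det_trig //.
rewrite -big_split /=; apply: ler_prod => i _.
rewrite -expr2 sqr_ge0 /=; apply: le_trans (expR_ge1Dx _).
rewrite addrC subrK -LE mxE (bigD1 i) //= mxE -expr2 lerDl.
by rewrite sumr_ge0 // => l _; rewrite mxE -expr2 sqr_ge0.
Qed.

Lemma ln_det_addid_le_tr k (X : 'M[R]_k) : possemidefmx X ->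
  ln (\det (X + 1%:M)) <= \tr X.
Proof.
move=> /posdefmxD /(_ (posdefmx1 k)) /ln_det_le_tr.
by rewrite mxtraceD mxtrace1 addrK.
Qed.

(** Apply [ln_det_le_tr] to the inverse of [A = X + 1], whose diagonal entries
    are at most 1: with [x = A^-1 e_i] one has
    [(A^-1)_ii = x^T A x >= x^T x >= (A^-1)_ii ^ 2]. *)
Lemma ln_det_addid_ge0 k (X : 'M[R]_k) : possemidefmx X ->
  0 <= ln (\det (X + 1%:M)).
Proof.
move=> pX; have pA := posdefmxD pX (posdefmx1 k).
set A := X + 1%:M in pA *.
have pV := posdefmx_inv pA; have uA := posdefmx_unit pA.
have dA := posdefmx_det_gt0 pA.
have := ln_det_le_tr pV.
rewrite det_inv lnV ?posrE// => h.
suff : \tr (invmx A) <= k%:R by lra.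
rewrite -[leRHS](_ : \sum_(i < k) 1 = _); last by rewrite sumr_const card_ord.
apply: ler_sum => i _.
have [sV _] := pV; have [sX qX] := pX.
have Vi := posdefmx_diag_gt0 i pV.
set x := col i (invmx A).
have e : (x^T *m A *m x) 0 0 = invmx A i i.
  have -> : x^T = row i (invmx A) by rewrite /x tr_col sV.
  by rewrite -row_mul mulVmx // -row_mul mul1mx !mxE.
have := qX x; move: e; rewrite /A mulmxDr mulmxDl mulmx1 mxE => e q.
have n2 : invmx A i i ^+ 2 <= (x^T *m x) 0 0.
  rewrite mxE (bigD1 i) //= /x !mxE -expr2 lerDl sumr_ge0 // => l _.
  by rewrite [_^T _ _]mxE -expr2 sqr_ge0.
rewrite -/A in e; nra.
Qed.

(** [Q P Q + P Q P = (P + Q) P Q = 2 P Q] is a sum of two congruences. *)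
Lemma posdefmx_mulmx_comm k (P Q : 'M[R]_k) :
  posdefmx P -> posdefmx Q -> P + Q = 2%:R%:M -> P *m Q = Q *m P ->
  posdefmx (P *m Q).
Proof.
move=> pP pQ PQ2 PQ; have [sP _] := pP; have [sQ _] := pQ.
have := posdefmx_congr pP (posdefmx_unit pQ).
have := posdefmx_congr pQ (posdefmx_unit pP).
rewrite sP sQ => pPQP /posdefmx_semi /posdefmxD /(_ pPQP).
have -> : Q *m P *m Q + P *m Q *m P = 2%:R *: (P *m Q).
  by rewrite -PQ -mulmxDr [Q + P]addrC PQ2 mul_mx_scalar.
move=> /(@posdefmxZ R _ 2^-1); rewrite scalerA mulVf ?scale1r ?pnatr_eq0//.
by apply; rewrite invr_gt0 ltr0n.
Qed.

(** Lagrange's identity: the difference, counted twice, is a sum of squares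
    over all pairs of indices. *)
Lemma cauchy_schwarz_sum (I : finType) (a b : I -> R) :
  (\sum_i a i * b i) ^+ 2 <= (\sum_i a i ^+ 2) * (\sum_i b i ^+ 2).
Proof.
rewrite -subr_ge0 expr2 !mulr_suml -sumrB.
under eq_bigr do rewrite !mulr_sumr -sumrB.
set S := \sum_i _; have SE : S = \sum_j \sum_i
    (a i ^+ 2 * b j ^+ 2 - a i * b i * (a j * b j)).
  by rewrite /S exchange_big.
have : 0 <= S + S.
  rewrite {2}SE /S -big_split /=; apply: sumr_ge0 => i _.
  rewrite -big_split /=; apply: sumr_ge0 => j _.
  have -> : forall x y x1 y1 : R, x ^+ 2 * y1 ^+ 2 - x * y * (x1 * y1) +
      (x1 ^+ 2 * y ^+ 2 - x1 * y1 * (x * y)) = (x * y1 - x1 * y) ^+ 2.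
    by move=> *; ring.
  exact: sqr_ge0.
lra.
Qed.

Lemma cauchy_schwarz_mx k (u v : 'rV[R]_k) (K : 'M[R]_k) :
  ((u *m K *m v^T) 0 0) ^+ 2 <=
  (u *m u^T) 0 0 * (v *m v^T) 0 0 * \tr (K *m K^T).
Proof.
have -> : (u *m K *m v^T) 0 0 =
    \sum_(p : 'I_k * 'I_k) (u 0 p.2 * v 0 p.1) * K p.2 p.1.
  rewrite -(pair_bigA _ (fun i j => u 0 j * v 0 i * K j i)) /= mxE.
  apply: eq_bigr => i _; rewrite !mxE mulr_suml; apply: eq_bigr => j _; ring.
apply: le_trans (cauchy_schwarz_sum _ _) _.
rewrite le_eqVlt; apply/orP; left; apply/eqP; congr (_ * _).
  rewrite -(pair_bigA _ (fun i j => (u 0 j * v 0 i) ^+ 2)) /= mulrC !mxE mulr_suml.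
  apply: eq_bigr => i _; rewrite mulr_sumr; apply: eq_bigr => j _.
  by rewrite !mxE; ring.
rewrite -(pair_bigA _ (fun i j => K j i ^+ 2)) /= exchange_big; apply: eq_bigr => i _.
by rewrite mxE; apply: eq_bigr => j _; rewrite mxE.
Qed.

(** Quantitative concavity of the log-determinant, measured by a single entry.
    Write [S = L L^T], [P = L (1 + K) L^T] and [Q = L (1 - K) L^T] with [K]
    symmetric.  Then [det P * det Q = det S ^ 2 * det (1 - K ^ 2)], and the last
    logarithm is at most [- tr (K ^ 2)].  The entry of [(P - Q) / 2] at [i, j]
    is the form [K] evaluated at rows [i] and [j] of [L], whose squared lengths
    are [S i i] and [S j j], so Cauchy-Schwarz bounds it by [tr (K ^ 2)]. *)
Lemma ln_det_midpoint k (P Q S : 'M[R]_k) (i j : 'I_k) :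
  posdefmx P -> posdefmx Q -> S = 2^-1 *: (P + Q) ->
  ln (\det P) + ln (\det Q) + ((P i j - Q i j) / 2) ^+ 2 / (S i i * S j j)
    <= 2 * ln (\det S).
Proof.
move=> pP pQ SE.
have h2 : 0 < 2^-1 :> R by rewrite invr_gt0.
have pS : posdefmx S.
  by rewrite SE; apply: posdefmxZ => //; apply: posdefmxD => //; apply: posdefmx_semi.
have [L [_ LE]] := cholesky pS.
have uL : L \in unitmx.
  by have := posdefmx_unit pS; rewrite -LE unitmx_mul => /andP[].
(* Congruence by [V] turns the midpoint [S] into the identity, and [P], [Q] into
   the commuting matrices [1 + K], [1 - K]. *)
pose V := invmx L; have uV : V \in unitmx by rewrite unitmx_inv.
pose P' := V *m P *m V^T; pose Q' := V *m Q *m V^T.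
have pP' : posdefmx P' by exact: posdefmx_congr.
have pQ' : posdefmx Q' by exact: posdefmx_congr.
have VS : V *m S *m V^T = 1%:M.
  by rewrite -LE /V !mulmxA mulVmx // mul1mx -trmx_mul mulVmx // trmx1.
have PQ2 : P' + Q' = 2%:R%:M.
  rewrite /P' /Q' -mulmxDl -mulmxDr -[2%:R%:M]scalemx1 -VS SE.
  by rewrite -scalemxAr -scalemxAl scalerA mulfV ?scale1r.
pose K := 2^-1 *: (P' - Q').
have P'E : P' = 1%:M + K.
  rewrite /K; apply/matrixP => a b; have := congr1 (fun X : 'M[R]_k => X a b) PQ2.
  by rewrite !mxE; case: (a == b) => /=; lra.
have Q'E : Q' = 1%:M - K.
  rewrite /K; apply/matrixP => a b; have := congr1 (fun X : 'M[R]_k => X a b) PQ2.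
  by rewrite !mxE; case: (a == b) => /=; lra.
have PQE : P' *m Q' = 1%:M - K *m K.
  by rewrite P'E Q'E mulmxDl !mulmxBr !mul1mx mulmx1 addrA subrK.
have QPE : Q' *m P' = 1%:M - K *m K.
  by rewrite P'E Q'E mulmxBl !mulmxDr !mul1mx mulmx1 opprD addrA addrK.
have sK : K^T = K.
  have [sP _] := pP'; have [sQ _] := pQ'.
  by rewrite /K linearZ /= linearB /= sP sQ.
have pPQ : posdefmx (P' *m Q') by apply: posdefmx_mulmx_comm => //; rewrite QPE.
have trK : ln (\det (P' *m Q')) <= - \tr (K *m K).
  have := ln_det_le_tr pPQ; rewrite PQE mxtraceD mxtrace1 linearN /=; lra.
have dS : \det S = \det L ^+ 2 by rewrite -LE det_mulmx det_tr.
have dV : \det V = (\det L)^-1 by rewrite det_inv.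
have dL : \det L != 0 by rewrite -unitfE -unitmxE.
have dSgt := posdefmx_det_gt0 pS.
have dPQ : ln (\det (P' *m Q')) = ln (\det P) + ln (\det Q) - 2 * ln (\det S).
  have -> : \det (P' *m Q') = \det P * \det Q / (\det S * \det S).
    by rewrite !det_mulmx !det_tr dV dS; field.
  have := posdefmx_det_gt0 pP; have := posdefmx_det_gt0 pQ => dQ dP.
  by rewrite ln_div ?posrE ?mulr_gt0// !lnM ?posrE// mulr_natl mulr2n.
have rowE a b (X : 'M[R]_k) : (row a L *m X *m (row b L)^T) 0 0 = (L *m X *m L^T) a b.
  by rewrite tr_row -row_mul !mxE; apply: eq_bigr => l _; rewrite !mxE.
have LL a : (row a L *m (row a L)^T) 0 0 = S a a.
  by have := rowE a a 1%:M; rewrite !mulmx1 LE.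
have LKL : (L *m K *m L^T) i j = (P i j - Q i j) / 2.
  have LVL (X : 'M[R]_k) : L *m (V *m X *m V^T) *m L^T = X.
    by rewrite /V !mulmxA mulmxV // mul1mx -mulmxA -trmx_mul mulmxV // trmx1 mulmx1.
  rewrite /K -scalemxAr -scalemxAl mulmxBr mulmxBl !LVL !mxE; ring.
have := cauchy_schwarz_mx (row i L) (row j L) K.
rewrite rowE !LL LKL sK => cs.
have Si := posdefmx_diag_gt0 i pS; have Sj := posdefmx_diag_gt0 j pS.
have cs' : ((P i j - Q i j) / 2) ^+ 2 / (S i i * S j j) <= \tr (K *m K).
  by rewrite ler_pdivrMr ?mulr_gt0// [leRHS]mulrC.
lra.
Qed.

End LogDet.

(** * The side-information matrix and its regularizer *)

Section SideInformation.
Context {R : realType}.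

Lemma mppinv_unit k (A : 'M[R]_k) : A \in unitmx -> mppinv A = invmx A.
Proof.
move=> uA; have hV : is_mppinv A (invmx A).
  by split; rewrite ?mulmxV ?mulVmx ?mul1mx ?trmx1.
rewrite /mppinv; case: xgetP => [X _ [AXA _ _ _]|/(_ (invmx A))]; last by [].
by rewrite -[X]mul1mx -(mulVmx uA) -[invmx A *m A *m X]mulmx1 -(mulmxV uA)
  mulmxA -(mulmxA _ A X) -(mulmxA _ (A *m X)) AXA mulVmx // mul1mx.
Qed.

Lemma le_radius k (A : 'M[R]_k) i : posdefmx A -> invmx A i i <= Defs.radius A.
Proof.
move=> /posdefmx_unit /mppinv_unit <-.
exact: (Order.TotalTheory.le_bigmax 0 (fun l => mppinv A l l)).
Qed.

Lemma radius_gt0 k (A : 'M[R]_k) : (0 < k)%N -> posdefmx A -> 0 < Defs.radius A.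
Proof.
move=> k0 pA; apply: lt_le_trans (le_radius (Ordinal k0) pA).
exact/posdefmx_diag_gt0/posdefmx_inv.
Qed.

(** The inverse of the square of [Gamma M sqM N sqN]; it turns the identity
    inside the regularizer into a shift of the matrix variable. *)
Definition invGammaSq m n (M : 'M[R]_m) (N : 'M[R]_n) : 'M[R]_(m + n) :=
  block_mx ((Defs.radius M)^-1 *: invmx M) 0 0 ((Defs.radius N)^-1 *: invmx N).

Section Gamma.
Variables (m n : nat) (M sqM : 'M[R]_m) (N sqN : 'M[R]_n).
Hypotheses (m_gt0 : (0 < m)%N) (n_gt0 : (0 < n)%N).
Hypotheses (pM : posdefmx M) (pN : posdefmx N).
Hypotheses (sqMP : is_sqrtmx sqM M) (sqNP : is_sqrtmx sqN N).

Lemma trmx_Gamma : (Gamma M sqM N sqN)^T = Gamma M sqM N sqN.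
Proof.
have [[sM _] _] := sqMP; have [[sN _] _] := sqNP.
by rewrite tr_block_mx !trmx0 !linearZ /= sM sN.
Qed.

Lemma Gamma_sq : Gamma M sqM N sqN *m Gamma M sqM N sqN =
  block_mx (Defs.radius M *: M) 0 0 (Defs.radius N *: N).
Proof.
have [_ sM] := sqMP; have [_ sN] := sqNP.
have rM := radius_gt0 m_gt0 pM; have rN := radius_gt0 n_gt0 pN.
rewrite mulmx_block !mulmx0 !mul0mx !addr0 !add0r.
rewrite -!scalemxAl -!scalemxAr !scalerA sM sN -!expr2 !sqr_sqrtr ?ltW//.
Qed.

Lemma posdefmx_invGammaSq : posdefmx (invGammaSq M N).
Proof.
have rM := radius_gt0 m_gt0 pM; have rN := radius_gt0 n_gt0 pN.
by apply: posdefmx_block; apply: posdefmxZ; rewrite ?invr_gt0//; exact: posdefmx_inv.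
Qed.

Lemma Gamma_invGammaSq :
  Gamma M sqM N sqN *m invGammaSq M N *m Gamma M sqM N sqN = 1%:M.
Proof.
have rM := radius_gt0 m_gt0 pM; have rN := radius_gt0 n_gt0 pN.
set G := Gamma _ _ _ _.
have GGU : G *m G *m invGammaSq M N = 1%:M.
  rewrite Gamma_sq mulmx_block !mulmx0 !mul0mx !addr0 !add0r.
  rewrite -!scalemxAl -!scalemxAr !scalerA !divff ?gt_eqF// !scale1r.
  by rewrite !mulmxV ?posdefmx_unit// -scalar_mx_block.
by apply: mulmx1C; rewrite mulmxA.
Qed.

(** This is the purpose of the normalization of [Gamma] by the radii: the shift
    at most doubles the bound 1 on the diagonal of a feasible matrix. *)
Lemma invGammaSq_diag_le1 i : invGammaSq M N i i <= 1.
Proof.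
have rM := radius_gt0 m_gt0 pM; have rN := radius_gt0 n_gt0 pN.
case: (split_ordP i) => l ->.
  by rewrite block_mxEul mxE mulrC ler_pdivrMr // mul1r le_radius.
by rewrite block_mxEdr mxE mulrC ler_pdivrMr // mul1r le_radius.
Qed.

End Gamma.

(** Evaluate the quadratic form at [e_i + e_j] and [e_i - e_j]. *)
Lemma posdefmx_entry_bound k (A : 'M[R]_k) i j :
  posdefmx A -> (forall l, A l l <= 1) -> `|A i j| <= 1.
Proof.
move=> pA dA; have [sA qA] := posdefmx_semi pA.
have sij : A j i = A i j by rewrite -{1}sA mxE.
have entry a b : (delta_mx 0 a *m A *m delta_mx b 0 : 'M[R]_1) 0 0 = A a b.
  by rewrite -rowE -colE !mxE.
have h e : 0 <= A i i + e * A i j * 2 + e ^+ 2 * A j j.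
  have := qA (delta_mx i 0 + e *: delta_mx j 0).
  have -> : (delta_mx i 0 + e *: delta_mx j 0 : 'cV[R]_k)^T = delta_mx 0 i + e *: delta_mx 0 j.
    by rewrite linearD linearZ /= !trmx_delta.
  rewrite !mulmxDl !mulmxDr -!scalemxAl -!scalemxAr.
  have addE (X Y : 'M[R]_1) : (X + Y) 0 0 = X 0 0 + Y 0 0 by rewrite mxE.
  have scaleE (X : 'M[R]_1) : (e *: X) 0 0 = e * X 0 0 by rewrite mxE.
  rewrite !(addE, scaleE) !entry sij; lra.
have := h 1; have := h (-1); have := dA i; have := dA j.
rewrite ler_norml; lra.
Qed.

Definition logdet k (G V : 'M[R]_k) : R := ln (\det (G *m V *m G + 1%:M)).

Section Regularizer.
Variables (m n : nat) (G U : 'M[R]_(m + n)) (D : R).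
Hypotheses (sG : G^T = G) (pU : posdefmx U) (GUG : G *m U *m G = 1%:M).
Hypothesis U_le1 : forall i, U i i <= 1.

Lemma feasible_semi (V : 'M[R]_(m + n)) :
  feasible G D V -> possemidefmx (G *m V *m G).
Proof.
move=> [/posdefmx_semi [sV qV] _ _]; split; first by rewrite !trmx_mul sG sV mulmxA.
move=> x; have := qV (G *m x); rewrite trmx_mul sG.
by congr (_ <= fun_of_matrix _ _ _); rewrite !mulmxA.
Qed.

Lemma feasible_ln_det_ge0 V : feasible G D V -> 0 <= logdet G V.
Proof. by move=> /feasible_semi /ln_det_addid_ge0. Qed.

Lemma feasible_ln_det_le V : feasible G D V -> logdet G V <= D.
Proof.
by move=> fV; case: (fV) => _ _; apply: le_trans; apply/ln_det_addid_le_tr/feasible_semi.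
Qed.

(** The weight [a] is positive because [X] may be singular, as Gram matrices of
    comparators are: mixing in a feasible [V] restores definiteness. *)
Lemma feasible_conv (a : R) V X : 0 < a -> a <= 1 -> feasible G D V ->
  possemidefmx X -> (forall i, X i i <= 1) -> \tr (G *m X *m G) <= D ->
  feasible G D (a *: V + (1 - a) *: X).
Proof.
move=> a0 a1 [pV dV tV] pX dX tX; split.
- rewrite addrC; apply: posdefmxD; first by apply: possemidefmxZ; rewrite ?subr_ge0.
  exact: posdefmxZ.
- by move=> i; rewrite !mxE; have := dV i; have := dX i; nra.
- rewrite mulmxDr mulmxDl mxtraceD -!scalemxAr -!scalemxAl !mxtraceZ; nra.
Qed.

Lemma feasible_midpoint V X : feasible G D V -> feasible G D X ->
  feasible G D (2^-1 *: (V + X)).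
Proof.
move=> fV [/posdefmx_semi pX dX tX].
have := @feasible_conv 2^-1 _ _ _ _ fV pX dX tX.
have -> : 1 - 2^-1 = 2^-1 :> R by lra.
by rewrite scalerDr; apply; lra.
Qed.

(** Since [1 = G U G], the matrix inside the determinant is [G (V + U) G]. *)
Lemma logdet_shift V : posdefmx V ->
  logdet G V = ln (\det G ^+ 2) + ln (\det (V + U)).
Proof.
move=> pV; rewrite /logdet -GUG -mulmxDl -mulmxDr !det_mulmx.
have dG : \det G != 0.
  rewrite -unitfE -unitmxE.
  have : G *m U *m G \in unitmx by rewrite GUG unitmx1.
  by rewrite unitmx_mul => /andP[].
have dVU := posdefmx_det_gt0 (posdefmxD (posdefmx_semi pV) pU).
by rewrite mulrAC -expr2 lnM ?posrE// lt_neqAle eq_sym expf_neq0 //= sqr_ge0.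
Qed.

(** The constant is absolute because the diagonal of [V + U] is at most 2, so
    that the denominator in [ln_det_midpoint] is at most 4. *)
Lemma logdet_strong_concavity V X i j : feasible G D V -> feasible G D X ->
  (logdet G V + logdet G X) / 2 + (V i j - X i j) ^+ 2 / 32 <=
    logdet G (2^-1 *: (V + X)).
Proof.
move=> fV fX; have [pS dS _] := feasible_midpoint fV fX.
have [pV _ _] := fV; have [pX _ _] := fX.
rewrite !logdet_shift //.
set S := 2^-1 *: (V + X) in pS dS *.
have SE : S + U = 2^-1 *: ((V + U) + (X + U)).
  by apply/matrixP => a b; rewrite /S !mxE; lra.
have pSU := posdefmxD (posdefmx_semi pS) pU.
have := ln_det_midpoint i j (posdefmxD (posdefmx_semi pV) pU)
  (posdefmxD (posdefmx_semi pX) pU) SE.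
have Si := posdefmx_diag_gt0 i pSU; have Sj := posdefmx_diag_gt0 j pSU.
have Si2 : (S + U) i i <= 2 by rewrite mxE; have := dS i; have := U_le1 i; lra.
have Sj2 : (S + U) j j <= 2 by rewrite mxE; have := dS j; have := U_le1 j; lra.
set q := _ ^+ 2 / _ => h.
have : (V i j - X i j) ^+ 2 / 16 <= q.
  rewrite /q !mxE; rewrite !mxE in Si Sj Si2 Sj2.
  have -> : V i j + U i j - (X i j + U i j) = V i j - X i j by ring.
  rewrite ler_pdivlMr; last by rewrite mulr_gt0 ?mxE.
  have := sqr_ge0 (V i j - X i j); set d := _ ^+ 2 => d0.
  rewrite expr_div_n -/d.
  have : (2^-1 * (V i i + X i i) + U i i) * (2^-1 * (V j j + X j j) + U j j) <= 4 by nra.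
  set p := _ * _ => p4; nra.
lra.
Qed.

(** Compare the minimizer [V] with the midpoint of [V] and [X], which is
    feasible; no first-order optimality condition is involved. *)
Lemma argmin_quadratic_growth (f : 'M[R]_(m + n) -> R) V X i j :
  (forall Y Z : 'M[R]_(m + n), f (2^-1 *: (Y + Z)) = (f Y + f Z) / 2) ->
  is_argmin (feasible G D) (fun Y => - logdet G Y + f Y) V -> feasible G D X ->
  - logdet G V + f V + (V i j - X i j) ^+ 2 / 16 <= - logdet G X + f X.
Proof.
move=> fmid [fV minV] fX.
have := minV _ (feasible_midpoint fV fX); rewrite fmid.
have := logdet_strong_concavity i j fV fX; lra.
Qed.

End Regularizer.
End SideInformation.

(** * Regret of the regularized leader *)

Section Frobenius.
Context {R : realType}.

Lemma frobDl k (A B L : 'M[R]_k) : frob (A + B) L = frob A L + frob B L.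
Proof.
rewrite /frob -big_split; apply: eq_bigr => a _.
by rewrite -big_split; apply: eq_bigr => b _; rewrite mxE mulrDl.
Qed.

Lemma frobZl k (a : R) (A L : 'M[R]_k) : frob (a *: A) L = a * frob A L.
Proof.
rewrite /frob mulr_sumr; apply: eq_bigr => b _.
by rewrite mulr_sumr; apply: eq_bigr => c _; rewrite mxE mulrA.
Qed.

Lemma frobDr k (A L L' : 'M[R]_k) : frob A (L + L') = frob A L + frob A L'.
Proof.
rewrite /frob -big_split; apply: eq_bigr => a _.
by rewrite -big_split; apply: eq_bigr => b _; rewrite mxE mulrDr.
Qed.

Lemma frobZr k (a : R) (A L : 'M[R]_k) : frob A (a *: L) = a * frob A L.
Proof.
rewrite /frob mulr_sumr; apply: eq_bigr => b _.
by rewrite mulr_sumr; apply: eq_bigr => c _; rewrite mxE mulrCA.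
Qed.

Lemma frob_delta k (A : 'M[R]_k) a b : frob A (delta_mx a b) = A a b.
Proof.
rewrite /frob (bigD1 a) //= [X in _ + X]big1 => [|c /negPf ca]; last first.
  by rewrite big1 // => l _; rewrite mxE ca mulr0.
rewrite (bigD1 b) //= [X in _ + X + _]big1 => [|c /negPf ca]; last first.
  by rewrite mxE ca andbF mulr0.
by rewrite !addr0 mxE !eqxx mulr1.
Qed.

Lemma frob_Zmx m n (A : 'M[R]_(m + n)) (a : 'I_m) (b : 'I_n) : A^T = A ->
  frob A (Zmx a b) = A (lshift n a) (rshift m b).
Proof.
move=> sA; rewrite frobZr frobDr !frob_delta -{2}sA mxE.
lra.
Qed.

End Frobenius.

Section Regret.
Context {R : realType}.
Variables (m n T : nat) (G U : 'M[R]_(m + n)) (D gamma s0 : R).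
Hypotheses (sG : G^T = G) (pU : posdefmx U) (GUG : G *m U *m G = 1%:M).
Hypotheses (U_le1 : forall l, U l l <= 1) (gamma_gt0 : 0 < gamma).
Variables (i : 'I_T -> 'I_m) (j : 'I_T -> 'I_n) (y : 'I_T -> R).
Hypothesis y_sign : forall t, y t = 1 \/ y t = -1.
Variable W : nat -> 'M[R]_(m + n).

Let eta : R := 16^-1 * gamma ^+ 2.
Hypothesis run : is_run s0 gamma eta G D i j y W.

Let miss := mistake s0 i j y W.
Let L := lossmx s0 gamma i j y W.
Let entry (t : 'I_T) (V : 'M[R]_(m + n)) := V (lshift n (i t)) (rshift m (j t)).

Definition cumloss (t : nat) (V : 'M[R]_(m + n)) : R :=
  \sum_(s < T | (s < t)%N) frob V (L s).

Definition mistakes_before (t : nat) : nat := \sum_(s < T | (s < t)%N) miss s.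

Definition ftrl_objective (t : nat) V := - logdet G V + eta * cumloss t V.
Local Notation F := ftrl_objective.

Lemma frob_lossmx V t : V^T = V ->
  frob V (L t) = if miss t then - (y t / gamma) * entry t V else 0.
Proof.
move=> sV; rewrite /L /lossmx -/miss; case: ifP => _; first by rewrite frobZr frob_Zmx.
by rewrite -[0](scale0r 0) frobZr mul0r.
Qed.

(** On a mistake the predicted score is zero or has the wrong sign, hence its
    loss is nonnegative. *)
Lemma mistake_frob_ge0 V (t : 'I_T) : W t = V -> miss t -> 0 <= frob V (L t).
Proof.
move=> <- mt; rewrite /L /lossmx -/miss mt frobZr.
move: mt; rewrite /miss /mistake /prediction /sgn; set x := frob _ _.
have [-> _|x0] := eqVneq x 0; first by rewrite mulr0.
rewrite mulNr oppr_ge0 mulrAC pmulr_lle0 ?invr_gt0//.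
have [xp|xn] := ltrP 0 x.
  rewrite gtr0_sg//; case: (y_sign t) => ->; first by rewrite eqxx.
  by rewrite mulN1r oppr_le0 ltW.
rewrite ltr0_sg ?lt_neqAle ?x0//; case: (y_sign t) => ->; last by rewrite eqxx.
by rewrite mul1r.
Qed.

Lemma cumlossS (t : 'I_T) V : cumloss t.+1 V = cumloss t V + frob V (L t).
Proof.
rewrite /cumloss (bigD1 t) //= addrC; congr (_ + _); apply: eq_bigl => s.
by rewrite ltnS -(inj_eq val_inj) /= andbC -ltn_neqAle.
Qed.

Lemma mistakes_beforeS (t : 'I_T) :
  mistakes_before t.+1 = (mistakes_before t + miss t)%N.
Proof.
rewrite /mistakes_before (bigD1 t) //= addnC; congr addn; apply: eq_bigl => s.
by rewrite ltnS -(inj_eq val_inj) /= andbC -ltn_neqAle.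
Qed.

Lemma cumloss_comb t a b V X :
  cumloss t (a *: V + b *: X) = a * cumloss t V + b * cumloss t X.
Proof.
rewrite /cumloss !mulr_sumr -big_split; apply: eq_bigr => s _.
by rewrite frobDl !frobZl.
Qed.

Lemma cumloss_no_mistake t V : mistakes_before t = 0%N -> cumloss t V = 0.
Proof.
move=> /eqP; rewrite sum_nat_eq0 => /forallP h.
rewrite /cumloss big1 // => s st; have := h s; rewrite st /= eqb0 => /negPf ms.
by rewrite /L /lossmx -/miss ms -[0](scale0r 0) frobZr mul0r.
Qed.

(** Each mistake lowers the minimum of the cumulative objective by at most
    [eta / 4].  If the entry that matters moves by [d], the objective gains
    [d ^ 2 / 16] by quadratic growth, while the new loss is at least
    [- |d| / gamma] because the old iterate has nonnegative loss on this round;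
    with [eta = gamma ^ 2 / 16] the sum [d ^ 2 / 16 - eta * |d| / gamma] is at
    least [- eta / 4] after completing the square.  The first mistake is
    different, as [W 0] is an arbitrary feasible matrix and not a minimizer:
    there the objective is bounded below directly, the regularizer by [- D] and
    the loss by [- 1 / gamma]. *)
Lemma follow_the_leader t : (t <= T)%N ->
  feasible G D (W t) /\
  ((0 < mistakes_before t)%N ->
   is_argmin (feasible G D) (F t) (W t) /\
   - D - eta / gamma - (mistakes_before t)%:R * (eta / 4) <= F t (W t)).
Proof.
have eta0 : 0 < eta by rewrite mulr_gt0 ?invr_gt0 ?exprn_gt0.
elim: t => [_|t IH tT].
  by split; [case: run | rewrite /mistakes_before big_pred0].
have [fW IHk] := IH (ltnW tT); pose o := Ordinal tT.
have [_ /(_ o)] := run; rewrite -/miss /=; have := mistakes_beforeS o.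
have FS V : F t.+1 V = F t V + eta * frob V (L o).
  by rewrite /F (cumlossS o) mulrDr addrA.
case: ifP => mo; rewrite /= => -> ; last first.
  move=> ->; split=> // k0; have [[_ amin] lb] := IHk (leq_trans k0 (eq_leq (addn0 _))).
  have FE V : F t.+1 V = F t V.
    by rewrite FS /L /lossmx -/miss mo -[0](scale0r 0) frobZr mul0r mulr0 addr0.
  by rewrite addn0; split; [split=> // V fV; rewrite !FE; exact: amin | rewrite FE].
move=> amin; have [fW1 _] := amin; split=> // _; split; first exact: amin.
have [[sW1 _] _ _] := fW1; have [[sW _] _ _] := fW.
rewrite FS natrD mulrDl mul1r.
have L0 := @mistake_frob_ge0 _ o erefl mo.
move: L0; rewrite !frob_lossmx // mo /= => L0.
have y2 : y o ^+ 2 = 1 by case: (y_sign o) => ->; rewrite ?sqrrN expr1n.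
have etaL z : eta * (- (y o / gamma) * z) = - (gamma * y o / 16) * z.
  by rewrite /eta; field; rewrite gt_eqF.
rewrite etaL; have : 0 <= eta * (- (y o / gamma) * entry o (W t)).
  by rewrite mulr_ge0// ltW.
rewrite etaL => {}L0; have etaE : eta = gamma ^+ 2 / 16 by rewrite mulrC.
have [k0|] := posnP (mistakes_before t); last first.
  move=> /IHk [amint lb].
  have fmid (Y Z : 'M[R]_(m + n)) : eta * cumloss t (2^-1 *: (Y + Z)) =
      (eta * cumloss t Y + eta * cumloss t Z) / 2.
    by rewrite scalerDr cumloss_comb; ring.
  have := argmin_quadratic_growth pU GUG U_le1 (lshift n (i o)) (rshift m (j o))
    fmid amint fW1.
  rewrite -/(F t (W t)) -/(F t (W t.+1)) -!/(entry o _).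
  move: (entry o (W t)) (entry o (W t.+1)) L0 => w x L0 growth.
  have sq : 0 <= (w - x) ^+ 2 + (w - x) * (gamma * y o) + gamma ^+ 2 / 4.
    (* The minimum over [w - x] of the sum is attained at [- gamma * y o / 2]. *)
    have := sqr_ge0 (w - x + gamma * y o / 2).
    have -> : (w - x + gamma * y o / 2) ^+ 2 =
      (w - x) ^+ 2 + (w - x) * (gamma * y o) + gamma ^+ 2 * y o ^+ 2 / 4 by field.
    by rewrite y2 mulr1.
  have : 0 <= eta / gamma by rewrite divr_ge0// ltW.
  rewrite etaE in lb *; lra.
rewrite k0 mul0r add0r /F cumloss_no_mistake // mulr0 addr0.
have := feasible_ln_det_le sG fW1; rewrite -/(logdet G _) => ld.
have : `|entry o (W t.+1)| <= 1 by case: fW1 => ? ? _; apply: posdefmx_entry_bound.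
have -> : eta / gamma = gamma / 16 by rewrite etaE; field; rewrite gt_eqF.
rewrite ler_norml -subr_ge0 opprK -[_ <= 1]subr_ge0 => /andP[x1 x2].
have gx1 := mulr_ge0 (ltW gamma_gt0) x1; have gx2 := mulr_ge0 (ltW gamma_gt0) x2.
by move: eta0; case: (y_sign o) => ->; lra.
Qed.

Lemma regret V : feasible G D V -> (0 < mistakes_before T)%N ->
  - D - eta / gamma - (mistakes_before T)%:R * (eta / 4) <= eta * cumloss T V.
Proof.
move=> fV k0; have [_ /(_ k0) [[_ /(_ V fV) amin] lb]] := follow_the_leader (leqnn T).
have := feasible_ln_det_ge0 sG fV; move: amin; rewrite {2}/F; lra.
Qed.

(** Continuity at 0 of an affine function, used to pass from feasible mixtures
    to a possibly singular comparator. *)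
Lemma le_of_le_affine (b x k : R) :
  (forall a, 0 < a -> a <= 1 -> b <= x + a * k) -> b <= x.
Proof.
move=> h; rewrite leNgt; apply/negP => xb.
have k1 : 0 < `|k| + 1 by rewrite ltr_wpDl.
pose a := Num.min 1 ((b - x) / (2 * (`|k| + 1))).
have a0 : 0 < a by rewrite lt_min ltr01 divr_gt0 ?subr_gt0// mulr_gt0.
have a1 : a <= 1 by rewrite ge_min lexx.
have a2 : a * (2 * (`|k| + 1)) <= b - x.
  by rewrite -ler_pdivlMr ?mulr_gt0// ge_min lexx orbT.
have := h a a0 a1; have := ler_norm k; nra.
Qed.

Lemma regret_semi X : possemidefmx X -> (forall l, X l l <= 1) ->
  \tr (G *m X *m G) <= D -> (0 < mistakes_before T)%N ->
  - D - eta / gamma - (mistakes_before T)%:R * (eta / 4) <= eta * cumloss T X.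
Proof.
move=> pX dX tX k0; have [fW _] := run.
apply: (@le_of_le_affine _ _ (eta * (cumloss T (W 0) - cumloss T X))) => a a0 a1.
have := regret (feasible_conv a0 a1 fW pX dX tX) k0.
rewrite cumloss_comb; lra.
Qed.

End Regret.

(** * Comparators and the mistake bound *)

Section Comparator.
Context {R : realType}.

Lemma l2norm_gt0 d (v : 'rV[R]_d) : v != 0 -> 0 < l2norm v.
Proof.
move=> v0; rewrite sqrtr_gt0 lt_neqAle sumr_ge0 ?andbT => [|k _]; last exact: sqr_ge0.
apply: contra v0; rewrite eq_sym psumr_eq0 => [/allP h|k _]; last exact: sqr_ge0.
apply/eqP/rowP => k; rewrite mxE.
by have := h k (mem_index_enum _); rewrite sqrf_eq0 => /eqP.
Qed.

Lemma normalize_rows_unit k d (P : 'M[R]_(k, d)) l : nonzero_rows P ->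
  (normalize_rows P *m (normalize_rows P)^T) l l = 1.
Proof.
move=> /(_ l) /l2norm_gt0 nP; rewrite mxE.
under eq_bigr do rewrite [_^T _ _]mxE !mxE -expr2 expr_div_n.
rewrite -mulr_suml /l2norm sqr_sqrtr; last by apply: sumr_ge0 => ? _; exact: sqr_ge0.
under [X in _ / X]eq_bigr do rewrite mxE.
rewrite divff //; move: nP; rewrite /l2norm sqrtr_gt0.
by under eq_bigr do rewrite mxE; move/gt_eqF ->.
Qed.

Lemma normalize_rows_mul m n d (P : 'M[R]_(m, d)) (Q : 'M[R]_(n, d)) a b :
  (normalize_rows P *m (normalize_rows Q)^T) a b =
  (row a P *m (row b Q)^T) 0 0 / (l2norm (row a P) * l2norm (row b Q)).
Proof.
rewrite !mxE mulr_suml; apply: eq_bigr => l _.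
by rewrite !mxE invfM mulrACA.
Qed.

Variables (m n T : nat) (M sqM : 'M[R]_m) (N sqN : 'M[R]_n) (D : R).
Hypotheses (m_gt0 : (0 < m)%N) (n_gt0 : (0 < n)%N).
Hypotheses (pM : posdefmx M) (pN : posdefmx N).
Hypotheses (sqMP : is_sqrtmx sqM M) (sqNP : is_sqrtmx sqN N).

(** The Gram matrix of the stacked normalized rows has unit diagonal and has [X]
    as its off-diagonal block; its [Gamma]-trace is the quasi-dimension that the
    definition of [comparators] bounds by [D]. *)
Lemma comparator_lift (X : 'M[R]_(m, n)) : comparators M N D X ->
  exists V : 'M[R]_(m + n),
   [/\ possemidefmx V, forall l, V l l <= 1,
       \tr (Gamma M sqM N sqN *m V *m Gamma M sqM N sqN) <= D &
       forall a b, V (lshift n a) (rshift m b) = X a b].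
Proof.
move=> [d [P [Q [nP nQ trPQ ->]]]]; set Pb := normalize_rows P in trPQ *.
set Qb := normalize_rows Q in trPQ *.
have VE : col_mx Pb Qb *m (col_mx Pb Qb)^T =
    block_mx (Pb *m Pb^T) (Pb *m Qb^T) (Qb *m Pb^T) (Qb *m Qb^T).
  by rewrite tr_col_mx mul_col_row.
exists (col_mx Pb Qb *m (col_mx Pb Qb)^T); split.
- exact: possemidefmx_gram.
- move=> l; rewrite VE; case: (split_ordP l) => k ->.
    by rewrite block_mxEul normalize_rows_unit.
  by rewrite block_mxEdr normalize_rows_unit.
- apply: le_trans trPQ; rewrite mxtrace_mulC !mulmxA mxtrace_mulC.
  rewrite (Gamma_sq m_gt0 n_gt0 pM pN sqMP sqNP) mul_block_col !mul0mx addr0 add0r.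
  rewrite tr_col_mx mul_row_col mxtraceD -!scalemxAl -!scalemxAr !mxtraceZ.
  by rewrite !mulmxA.
- by move=> a b; rewrite VE block_mxEur.
Qed.

Lemma hinge_ge0 (g x : R) : 0 < g -> 0 <= hinge g x.
Proof.
move=> g0; rewrite /hinge; case: (lerP g x) => [_|xg]; first exact: lexx.
by rewrite subr_ge0 ler_pdivrMr// mul1r ltW.
Qed.

Lemma hinge_ge (g x : R) : 0 < g -> 1 - x / g <= hinge g x.
Proof.
move=> g0; rewrite /hinge; case: (lerP g x) => [gx|_]; last exact: lexx.
by rewrite subr_le0 ler_pdivlMr// mul1r.
Qed.

Variables (gamma s0 : R) (i : 'I_T -> 'I_m) (j : 'I_T -> 'I_n) (y : 'I_T -> R).
Variable W : nat -> 'M[R]_(m + n).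
Hypothesis gamma_gt0 : 0 < gamma.
Hypothesis D_ge1 : 1 <= D.
Hypothesis y_sign : forall t, y t = 1 \/ y t = -1.
Hypothesis run :
  is_run s0 gamma (16^-1 * gamma ^+ 2) (Gamma M sqM N sqN) D i j y W.

Lemma nb_mistakesE : nb_mistakes s0 i j y W = mistakes_before s0 i j y W T.
Proof. by apply: eq_bigl => s; rewrite ltn_ord. Qed.

(** The loss matrices are linearizations of the hinge loss on the rounds with a
    mistake, and on the other rounds the hinge loss is nonnegative. *)
Lemma mistakes_le_hinge d (P : 'M[R]_(m, d)) (Q : 'M[R]_(n, d)) V :
  V^T = V ->
  (forall a b, V (lshift n a) (rshift m b) =
     (normalize_rows P *m (normalize_rows Q)^T) a b) ->
  (nb_mistakes s0 i j y W)%:R <=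
    hloss_PQ gamma i j y P Q - cumloss gamma s0 i j y W T V.
Proof.
move=> sV VE; rewrite /nb_mistakes natr_sum.
rewrite /hloss_PQ /cumloss [X in _ - X](eq_bigl xpredT) => [|s]; last by rewrite ltn_ord.
rewrite -sumrB; apply: ler_sum => t _.
rewrite -mulrA -normalize_rows_mul -VE frob_lossmx //.
case: (mistake _ _ _ _ _ t); last by rewrite subr0 hinge_ge0.
have := hinge_ge (y t * V (lshift n (i t)) (rshift m (j t))) gamma_gt0.
rewrite mulNr opprK mulrAC /=; lra.
Qed.

(** The regret bound divided by [eta] reads
    [mistakes <= hinge loss + 16 D / gamma ^ 2 + 1 / gamma + mistakes / 4].
    When there is at least one mistake, [1 / gamma] is absorbed by the
    arithmetic-geometric mean inequality as
    [mistakes / 4 + 1 / gamma ^ 2], and half of the mistakes remain on the left: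
    this is where the factor 2 of the hinge loss comes from. *)
Lemma mistake_bound d (P : 'M[R]_(m, d)) (Q : 'M[R]_(n, d)) :
  comparators M N D (normalize_rows P *m (normalize_rows Q)^T) ->
  (nb_mistakes s0 i j y W)%:R <=
    34 * (D / gamma ^+ 2) + 2 * hloss_PQ gamma i j y P Q.
Proof.
move=> /comparator_lift [V [pV dV tV VE]]; have [sV _] := pV.
have Dg : 0 < D / gamma ^+ 2.
  by rewrite divr_gt0 ?exprn_gt0 // (lt_le_trans ltr01).
have := mistakes_le_hinge sV VE.
have [->|k_gt0] := posnP (nb_mistakes s0 i j y W).
  move=> _; apply: addr_ge0; first by rewrite mulr_ge0 // ltW.
  by rewrite mulr_ge0 //; apply: sumr_ge0 => t _; exact: hinge_ge0.
have k_ge1 : 1 <= (nb_mistakes s0 i j y W)%:R :> R by rewrite ler1n.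
have := regret_semi (trmx_Gamma sqMP sqNP) (posdefmx_invGammaSq m_gt0 n_gt0 pM pN)
  (Gamma_invGammaSq m_gt0 n_gt0 pM pN sqMP sqNP)
  (invGammaSq_diag_le1 m_gt0 n_gt0 pM pN) gamma_gt0 y_sign run pV dV tV.
rewrite -nb_mistakesE => /(_ k_gt0).
move: (nb_mistakes _ _ _ _ _)%:R (cumloss _ _ _ _ _ _ _ _) (hloss_PQ _ _ _ _ _ _) k_ge1.
move=> k c h k_ge1 reg kh.
have g2 : 0 < gamma ^+ 2 by rewrite exprn_gt0.
(* The regret bound divided by [eta = gamma ^ 2 / 16]. *)
have {}reg : - (16 * (D / gamma ^+ 2)) - gamma^-1 - k / 4 <= c.
  have -> : - (16 * (D / gamma ^+ 2)) - gamma^-1 - k / 4 =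
     (- D - 16^-1 * gamma ^+ 2 / gamma - k * (16^-1 * gamma ^+ 2 / 4)) *
     (16 / gamma ^+ 2) by field; rewrite gt_eqF.
  by rewrite mulrA ler_pdivrMr //; lra.
have amgm : gamma^-1 <= k / 4 + D / gamma ^+ 2.
  have : gamma^-1 ^+ 2 <= D / gamma ^+ 2.
    by rewrite exprVn -[leLHS]mul1r ler_pM2r ?invr_gt0.
  have := sqr_ge0 (gamma^-1 - 2^-1); nra.
lra.
Qed.

End Comparator.

Theorem theorem2 (R : realType) :
  exists c : R, 0 < c /\ exists C : R, 0 < C /\
  forall (m n : nat) (gamma D s0 : R)
    (M sqM : 'M[R]_m) (N sqN : 'M[R]_n),
  (0 < m)%N -> (0 < n)%N ->
  0 < gamma -> 1 <= D ->
  posdefmx M -> posdefmx N ->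
  is_sqrtmx sqM M -> is_sqrtmx sqN N ->
  forall (T : nat) (i : 'I_T -> 'I_m) (j : 'I_T -> 'I_n) (y : 'I_T -> R),
  (forall t, y t = 1 \/ y t = -1) ->
  forall W : nat -> 'M[R]_(m + n),
  is_run s0 gamma (c * gamma ^+ 2) (Gamma M sqM N sqN) D i j y W ->
  (((nb_mistakes s0 i j y W)%:R)%:E <=
     (C * (D / gamma ^+ 2))%:E + 2%:E * hloss M N D gamma i j y)%E.
Proof.
exists 16^-1; split; first by rewrite invr_gt0.
exists 34; split=> //.
move=> m n gamma D s0 M sqM N sqN m0 n0 g0 D1 pM pN sqMP sqNP T i j y yP W run.
set k := (nb_mistakes _ _ _ _ _)%:R; set C := 34 * _.
have : (((k - C) / 2)%:E <= hloss M N D gamma i j y)%E.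
  apply/ereal_infP => _ [d [P [Q [_ _ XPQ ->]]]]; rewrite lee_fin.
  have := mistake_bound m0 n0 pM pN sqMP sqNP g0 D1 yP run XPQ.
  rewrite -/k -/C; lra.
case: (hloss _ _ _ _ _ _ _) => [h| |] //.
  rewrite -EFinM -EFinD !lee_fin. lra.
by move=> _; rewrite gt0_muley ?lte_fin // addey // leey.
Qed.
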